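(* Let $n,A,B\in\mathbb{N}$, $n>1$. Then $$\phi(n,A,B)=\frac{B-A}{n}\,\phi(n)+\delta_{n,A}+O\left(\sum_{d\mid n}\mu(d)^2\right),$$ where $\delta_{n,A}=1$ if $(n,A)=1$ and $\delta_{n,A}=0$ otherwise.
   Context: $\mathbb{N}$ denotes the positive integers and $(\cdot,\cdot)$ the greatest common divisor. $\phi(n)$ (with one argument) is Euler's totient function and $\mu$ is the Möbius function. The generalized totient function (with three arguments) is $$\phi(n,A,B):=\sum_{\substack{A\leq k\leq B\\ (n,k)=1}}1,$$ the number of integers $k$ with $A\leq k\leq B$ and $(n,k)=1$.
   Formalization: The formal theorem also assumes A ≤ B, without which the claim fails (n = 2, B = 1, A large and even: the count is 0 and the error sum is 2, but (B−A)φ(n)/n is unbounded). *)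

(* Defs.v *)
From mathcomp Require Import all_boot all_order all_algebra.
From mathcomp Require Import reals.

Set Implicit Arguments.
Unset Strict Implicit.
Unset Printing Implicit Defensive.

Import Order.TTheory GRing.Theory Num.Theory.

Local Open Scope nat_scope.

Definition squarefree (n : nat) : bool :=
  (0 < n) && all (fun p => ~~ (p ^ 2 %| n)) (primes n).

(* The value at 0, where the Moebius function is not defined, is 0. *)
Definition moebius (n : nat) : int :=
  if squarefree n then ((-1) ^+ size (primes n))%R else 0%R.

Definition totient3 (n A B : nat) : nat :=
  \sum_(A <= k < B.+1 | coprime n k) 1.

Definition delta (n A : nat) : nat := if coprime n A then 1 else 0.

(* Main.v *)
Require Import Defs.
From mathcomp Require Import all_boot all_order all_algebra.
From mathcomp Require Import reals.
From mathcomp Require Import zify ring lra.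

Set Implicit Arguments.
Unset Strict Implicit.
Unset Printing Implicit Defensive.

Import Order.TTheory GRing.Theory Num.Theory.
Local Open Scope ring_scope.

(** Removing the multiples of the prime divisors [p] of [n] one at a time,
    as in Legendre's sieve, shows that the number of [k < x] coprime to [n]
    is [x * \prod_p (1 - 1/p)] up to an error that is doubled and increased
    by at most 1 at each step, hence at most [2 ^ w - 1] with [w] the number
    of primes.  On the other hand the sum of [mu(d)^2] is at least [2 ^ w],
    since products of subsets of the primes are distinct squarefree divisors
    of [n]. *)

Definition sifted (s : seq nat) (k : nat) : bool :=
  all (fun p => ~~ (p %| k)%N) s.

(** The half-open range makes the count over [A <= k <= B] the difference of the values at [B.+1]
    and [A]. *)
Definition sieve (s : seq nat) (x : nat) : nat :=
  (\sum_(0 <= k < x) sifted s k)%N.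

Lemma sieveS s x : sieve s x.+1 = (sieve s x + sifted s x)%N.
Proof. by rewrite /sieve big_nat_recr. Qed.

Lemma coprime_sifted n k : (1 < n)%N -> coprime n k = sifted (primes n) k.
Proof.
move=> n_gt1; apply/idP/allP => [co_nk p | sif].
  rewrite mem_primes => /and3P[p_pr _ p_n]; apply/negP => p_k.
  have : (p %| gcdn n k)%N by rewrite dvdn_gcd p_n.
  by rewrite (eqP co_nk) dvdn1 => /eqP p1; rewrite p1 in p_pr.
apply: contraT => nco.
have g_gt0 : (0 < gcdn n k)%N by rewrite gcdn_gt0; lia.
have g_gt1 : (1 < gcdn n k)%N by move: nco; rewrite /coprime; lia.
have /negP[] : ~~ (pdiv (gcdn n k) %| k)%N.
  apply: sif; rewrite mem_primes pdiv_prime // (ltnW n_gt1) /=.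
  exact: dvdn_trans (pdiv_dvd _) (dvdn_gcdl _ _).
exact: dvdn_trans (pdiv_dvd _) (dvdn_gcdr _ _).
Qed.

(** A prime outside [s] brings no divisor from [s]; hence the multiples of [p] that survive [s]
    match the survivors among their quotients. *)
Lemma sifted_mul p s j :
  prime p -> all prime s -> p \notin s -> sifted s (p * j) = sifted s j.
Proof.
move=> p_pr /allP s_pr p_s; apply: eq_in_all => q q_s.
have q_pr := s_pr q q_s; rewrite Euclid_dvdM // dvdn_prime2 //.
by case: eqP => // q_p; rewrite -q_p q_s in p_s.
Qed.

(* The number [y] is [x / p] rounded up. *)
Lemma sieve_cons p s x : prime p -> all prime s -> p \notin s ->
  exists2 y, (x <= p * y < x + p)%N
    & (sieve (p :: s) x + sieve s y = sieve s x)%N.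
Proof.
move=> p_pr s_pr p_s; have p_gt0 := prime_gt0 p_pr.
elim: x => [|x [y bnd IH]].
  by exists 0%N; rewrite /sieve ?big_geq //; lia.
rewrite !sieveS -IH.
have -> : sifted (p :: s) x = ~~ (p %| x)%N && sifted s x by [].
case: (boolP (p %| x)%N) => [/dvdnP[j def_x] | ndvd].
  (* The window [[x, x + p)] contains a single multiple of [p], here [x] itself. Passing to [x.+1]
     moves the rounded-up quotient on by one, and both sides gain the same term. *)
  have y_j : y = j.
    move: bnd; rewrite def_x mulnC -mulnSr leq_pmul2l // ltn_pmul2l //.
    by rewrite ltnS => le_yj; apply/eqP; rewrite eqn_leq andbC.
  have sif_x : sifted s x = sifted s y by rewrite def_x mulnC y_j sifted_mul.
  exists y.+1; first by rewrite mulnSr y_j def_x (mulnC j); lia.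
  by rewrite sieveS sif_x addn0 addnA.
(* Here [x < p * y] strictly, so the same [y] still serves for [x.+1]. *)
exists y; last by rewrite addnAC.
have : (x != p * y)%N by apply: contraNneq ndvd => ->; exact: dvdn_mulr.
lia.
Qed.

Definition density (R : realType) (s : seq nat) : R :=
  \prod_(p <- s) (1 - p%:R^-1).

Lemma density_itv (R : realType) s :
  all prime s -> 0 <= density R s <= 1.
Proof.
rewrite /density; elim: s => [|p s IH] /=.
  by rewrite big_nil ler01 lexx.
case/andP=> p_pr /IH; rewrite big_cons => /andP[P0 P1].
have p_ge1 : 1 <= p%:R :> R by rewrite ler1n prime_gt0.
have V0 : 0 <= p%:R^-1 :> R by rewrite invr_ge0 ler0n.
have V1 : p%:R^-1 <= 1 :> R by rewrite invf_le1 // (lt_le_trans ltr01).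
by apply/andP; split; nra.
Qed.

(** The induction on [s] keeps [x] general, because [sieve_cons] calls for the hypothesis at both
    [x] and [y]. *)
Lemma sieve_density (R : realType) s x : all prime s -> uniq s ->
  `|(sieve s x)%:R - x%:R * density R s| <= 2 ^+ size s - 1.
Proof.
elim: s x => [|p s IH] x /=.
  move=> _ _; rewrite /sieve /density big_nil sum_nat_const_nat subn0 muln1.
  by rewrite mulr1 expr0 !subrr normr0.
case/andP=> p_pr s_pr /andP[p_s s_uniq].
have [y /andP[x_le lt_x] eqn] := sieve_cons x p_pr s_pr p_s.
have := IH x s_pr s_uniq; have := IH y s_pr s_uniq.
have /andP[P0 P1] := density_itv R s_pr.
have p_gt0 : 0 < p%:R :> R by rewrite ltr0n prime_gt0.
have -> : density R (p :: s) = (1 - p%:R^-1) * density R s.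
  by rewrite /density big_cons.
have lo : x%:R / p%:R <= y%:R :> R.
  by rewrite ler_pdivrMr // mulrC -natrM ler_nat.
have hi : y%:R <= x%:R / p%:R + 1 :> R.
  rewrite -lerBlDr ler_pdivlMr // mulrBl mul1r lerBlDr -natrM -natrD ler_nat.
  by lia.
rewrite -eqn natrD exprS !ler_norml => /andP[a1 a2] /andP[b1 b2].
move: (density R s) (sieve _ _)%:R (sieve _ _)%:R P0 P1 a1 a2 b1 b2.
move=> P u v P0 P1 a1 a2 b1 b2.
(* Replacing [x / p] by [y] costs at most 1 in the main term; with the two inductive errors this
   gives [2 * (2 ^ w - 1) + 1 = 2 ^ w.+1 - 1]. *)
have e1 : 0 <= (y%:R - x%:R / p%:R) * P by rewrite mulr_ge0 // subr_ge0.
have e2 : (y%:R - x%:R / p%:R) * P <= 1.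
  by rewrite -[leRHS]mulr1 ler_pM // ?subr_ge0 // lerBlDl.
by apply/andP; split; lra.
Qed.

(** Each prime power [p ^ e] exactly dividing [n] contributes [(p - 1) * p ^ (e - 1) / p ^ e = 1 - 1
    / p]. *)
Lemma totient_density (R : realType) n :
  (0 < n)%N -> (totient n)%:R / n%:R = density R (primes n).
Proof.
move=> n_gt0; rewrite totientE // {3}(prod_prime_decomp n_gt0).
rewrite prime_decompE big_map /= !natr_prod -prodf_div /density.
apply: eq_big_seq => p; rewrite mem_primes => /and3P[p_pr _ p_n].
have p_gt0 := prime_gt0 p_pr.
(* A positive exponent ensures that its truncated predecessor is the true [e - 1]. *)
have : (0 < logn p n)%N by rewrite logn_gt0 mem_primes p_pr n_gt0.
case: (logn p n) => // e _ /=.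
have pN0 : p%:R != 0 :> R by rewrite pnatr_eq0 -lt0n.
have peN0 : p%:R ^+ e != 0 :> R by rewrite expf_neq0.
by rewrite -subn1 natrM natrB // !natrX exprS; field; rewrite pN0 peN0.
Qed.

Lemma totient3_sieve n A B : (1 < n)%N -> (A <= B)%N ->
  (sieve (primes n) A + totient3 n A B = sieve (primes n) B.+1)%N.
Proof.
move=> n_gt1 leAB; rewrite /totient3 /sieve.
rewrite (@big_cat_nat _ _ _ A 0 B.+1) //=; last by lia.
congr addn; rewrite big_mkcond; apply: eq_bigr => k _.
by rewrite coprime_sifted //; case: sifted.
Qed.

Lemma prod_primes_gt0 s : all prime s -> (0 < \prod_(p <- s) p)%N.
Proof.
elim: s => [|p s IH] /=; first by rewrite big_nil.
case/andP=> p_pr s_pr; rewrite big_cons muln_gt0 prime_gt0 //=; exact: IH.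
Qed.

Lemma logn_prod_primes s q : all prime s -> prime q ->
  logn q (\prod_(p <- s) p)%N = count_mem q s.
Proof.
move=> + q_pr; elim: s => [|p s IH] /=; first by rewrite big_nil logn1.
case/andP=> p_pr s_pr; rewrite big_cons lognM;
  rewrite ?prod_primes_gt0 ?(prime_gt0 p_pr) //.
by rewrite IH // logn_prime // eq_sym.
Qed.

Lemma dvdn_prod_primes s q : all prime s -> prime q ->
  (q %| \prod_(p <- s) p)%N = (q \in s).
Proof.
move=> s_pr q_pr; rewrite -has_pred1 has_count -logn_prod_primes //.
by rewrite logn_gt0 mem_primes q_pr prod_primes_gt0.
Qed.

Lemma prod_primes_dvd s n : all prime s -> uniq s ->
  all (fun p => p %| n)%N s -> (\prod_(p <- s) p %| n)%N.
Proof.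
elim: s => [|p s IH] /=; first by rewrite big_nil dvd1n.
move=> /andP[p_pr s_pr] /andP[p_s s_uniq] /andP[p_n s_n].
rewrite big_cons Gauss_dvd ?p_n ?IH //.
by rewrite prime_coprime // dvdn_prod_primes.
Qed.

(** As a list, the subset products have length [2 ^ size s] by construction, which leaves only their
    distinctness to prove. *)
Fixpoint subproducts (s : seq nat) : seq nat :=
  if s is p :: s' then
    subproducts s' ++ [seq (p * d)%N | d <- subproducts s']
  else [:: 1%N].

Lemma size_subproducts s : size (subproducts s) = (2 ^ size s)%N.
Proof.
by elim: s => //= p s IH; rewrite size_cat size_map IH expnS mul2n addnn.
Qed.

Lemma subproducts_dvd s d : d \in subproducts s -> (d %| \prod_(p <- s) p)%N.
Proof.
elim: s d => [|p s IH] d /=; first by rewrite inE big_nil => /eqP->.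
rewrite mem_cat big_cons => /orP[/IH /dvdn_mull -> // | /mapP[e /IH e_s ->]].
exact: dvdn_mul.
Qed.

(** The two halves are disjoint: an entry [p * e] in the first half would make [p] divide the
    product of the remaining primes, hence be one of them. *)
Lemma subproducts_uniq s : all prime s -> uniq s -> uniq (subproducts s).
Proof.
elim: s => [|p s IH] //= /andP[p_pr s_pr] /andP[p_s s_uniq].
rewrite cat_uniq map_inj_uniq ?IH ?andbT //=; last first.
  by move=> d e /eqP; rewrite eqn_pmul2l ?prime_gt0 // => /eqP.
apply/hasPn => _ /mapP[e _ ->]; apply: contra p_s => /subproducts_dvd pe.
by rewrite -dvdn_prod_primes // (dvdn_trans (dvdn_mulr e (dvdnn p))).
Qed.

(** In a product of distinct primes every prime has exponent at most 1, so no square of a prime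
    divides it. *)
Lemma squarefree_dvd_prod s d : all prime s -> uniq s ->
  (d %| \prod_(p <- s) p)%N -> squarefree d.
Proof.
move=> s_pr s_uniq d_s; have s_gt0 := prod_primes_gt0 s_pr.
rewrite /squarefree (dvdn_gt0 s_gt0 d_s); apply/allP => p.
rewrite mem_primes => /andP[p_pr _]; apply/negP => /dvdn_trans/(_ d_s).
rewrite pfactor_dvdn // logn_prod_primes // count_uniq_mem //.
by case: (_ \in _).
Qed.

Lemma sum_moebius_sqr (R : realType) n :
  (\sum_(d <- divisors n) ((moebius d)%:~R : R) ^+ 2)
    = (count squarefree (divisors n))%:R.
Proof.
rewrite -sum1_count natr_sum [RHS]big_mkcond; apply: eq_bigr => d _.
rewrite /moebius; case: squarefree; last by rewrite expr0n.
by rewrite rmorphXn rmorphN1 /= sqrr_sign.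
Qed.

Lemma count_squarefree_divisors n : (0 < n)%N ->
  (2 ^ size (primes n) <= count squarefree (divisors n))%N.
Proof.
move=> n_gt0; have n_pr := all_prime_primes n; have n_uniq := primes_uniq n.
rewrite -size_subproducts -size_filter.
apply: uniq_leq_size; first exact: subproducts_uniq.
move=> d /subproducts_dvd d_n; rewrite mem_filter -dvdn_divisors //.
rewrite (squarefree_dvd_prod n_pr n_uniq d_n) (dvdn_trans d_n) //.
apply: prod_primes_dvd => //; apply/allP => p.
by rewrite mem_primes => /and3P[].
Qed.

Theorem proposition1p9 (R : realType) :
  exists C : R, forall n A B : nat,
    (1 < n)%N -> (0 < A)%N -> (0 < B)%N -> (A <= B)%N ->
    `| (totient3 n A B)%:R
       - ((B%:R - A%:R) / n%:R * (totient n)%:R + (delta n A)%:R) |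
    <= C * `| \sum_(d <- divisors n) ((moebius d)%:~R : R) ^+ 2 |.
Proof.
(* The sieve errors at [A] and [B.+1] are at most [2 ^ w - 1] each. The main term [(B + 1 - A) * P],
   with [P] the density, exceeds [(B - A) * P + delta n A] by [P - delta n A], which lies in
   [[-1, 1]]. The total is at most [2 * 2 ^ w - 1]. *)
exists 2 => n A B n_gt1 _ _ leAB; have n_gt0 := ltnW n_gt1.
have n_pr := all_prime_primes n; have n_uniq := primes_uniq n.
rewrite sum_moebius_sqr normr_nat mulrAC -mulrA totient_density //.
have le_count : 2 ^+ size (primes n)
    <= (count squarefree (divisors n))%:R :> R.
  by rewrite -natrX ler_nat count_squarefree_divisors.
have := sieve_density R A n_pr n_uniq.
have := sieve_density R B.+1 n_pr n_uniq.
have /andP[P0 P1] := density_itv R n_pr.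
have D0 : 0 <= (delta n A)%:R :> R by rewrite ler0n.
have D1 : (delta n A)%:R <= 1 :> R by rewrite /delta lern1; case: coprime.
rewrite -(totient3_sieve n_gt1 leAB) natrD -natr1 !ler_norml.
by move=> /andP[b1 b2] /andP[a1 a2]; apply/andP; split; lra.
Qed.
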